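(* Let $\Bbbk$ be an infinite field and $S=\Bbbk[x_1,x_2,x_3,x_4]$. Let $I=(f,g)\subset S$ be a homogeneous complete intersection ideal, with $f,g$ homogeneous, where $g=\prod_{i=1}^e l_i$ for some linear forms $l_i\in S_1$ and $\gcd(f,g)=1$. Then $I$ is Hirsch, i.e. $\operatorname{diam}(I)\le\operatorname{height}(I)$.
   Context: $S$ has the standard grading and $S_1$ is its degree-one component; ideals considered are proper. For an ideal $I\subset S$ let $\operatorname{Min}(I)=\{\mathfrak{p}_1,\ldots,\mathfrak{p}_s\}$ be its set of minimal primes. The dual graph $G(I)$ is the simple graph with vertex set $\{1,\ldots,s\}$ in which $\{i,j\}$ (with $i\ne j$) is an edge if and only if $\operatorname{height}(\mathfrak{p}_i+\mathfrak{p}_j)=\operatorname{height}(I)+1$. The diameter $\operatorname{diam}(I)$ is the diameter of the graph $G(I)$: the maximum over pairs of vertices of their distance, where the distance of two vertices is the minimum number of edges in a path connecting them ($0$ if they are equal, $\infty$ if no path connects them). The ideal $I$ is called Hirsch if $\operatorname{diam}(I)\le\operatorname{height}(I)$. *)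

(* Defs.v *)
(* Ideals are boolean predicates; classically ([boolp]) these are all subsets. *)
From HB Require Import structures.
From mathcomp Require Import all_boot all_order all_algebra.
From mathcomp Require Import ring_quotient.
From mathcomp Require Import boolp.
From mathcomp Require classical_sets cardinality.
From mathcomp Require Import mpoly.

Set Implicit Arguments.
Unset Strict Implicit.
Unset Printing Implicit Defensive.

Import GRing.Theory.
Local Open Scope ring_scope.

(* Extended natural numbers: [None] is infinity. *)
Definition enat := option nat.

Definition ele (a b : enat) : Prop :=
  match a, b with
  | _, None => True
  | None, Some _ => False
  | Some m, Some n => (m <= n)%N
  end.

Definition esucc (a : enat) : enat := omap S a.

(* inf of the empty set is infinity, sup of the empty set is 0. *)
Definition einf (A : enat -> Prop) : enat :=
  match pselect (exists n, `[< A (Some n) >]) with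
  | left exA => Some (ex_minn exA)
  | right _ => None
  end.

Definition esup (A : enat -> Prop) : enat :=
  einf (fun b => forall a, A a -> ele a b).

Lemma einf_lb (A : enat -> Prop) a : A a -> ele (einf A) a.
Proof.
rewrite /einf; case: a => [n|] An; last by case: pselect.
case: pselect => [exA|[]]; last by exists n; apply/asboolP.
by case: ex_minnP => m _; apply; apply/asboolP.
Qed.

Lemma einf_glb (A : enat -> Prop) b :
  (forall a, A a -> ele b a) -> ele b (einf A).
Proof.
rewrite /einf => lbA; case: pselect => [exA|_]; last by case: b lbA.
by case: ex_minnP => m /asboolP Am _; exact: lbA.
Qed.

Lemma esup_ub (A : enat -> Prop) a : A a -> ele a (esup A).
Proof. by move=> Aa; apply: einf_glb => b; apply. Qed.

Lemma esup_lub (A : enat -> Prop) b :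
  (forall a, A a -> ele a b) -> ele (esup A) b.
Proof. by move=> ubA; apply: einf_lb. Qed.

Section Graph.
Variables (V : Type) (e : rel V).

Definition distance (x y : V) : enat :=
  einf (fun a => exists s : seq V,
    [/\ path e x s, last x s = y & a = Some (size s)]).

Definition diameter : enat :=
  esup (fun a => exists x y : V, a = distance x y).

End Graph.

Section Ideals.
Variable R : comNzRingType.
Implicit Types (I J P Q : {pred R}) (s : seq R).

(* [idealr_closed] already includes [1 \notin P]. *)
Definition is_prime_ideal P : Prop :=
  idealr_closed P /\ prime_idealr_closed P.

Definition ideal_gen s : {pred R} :=
  [pred x | `[< exists c : nat -> R, x = \sum_(i < size s) c i * s`_i >]].

Definition ideal_add I J : {pred R} :=
  [pred x | `[< exists a b : R, [/\ a \in I, b \in J & x = a + b] >]].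

Definition strict_subset I J : Prop :=
  {subset I <= J} /\ ~ {subset J <= I}.

(* c 0 < c 1 < ... < c n = P, of length n. *)
Definition prime_chain_to P (n : nat) (c : nat -> {pred R}) : Prop :=
  [/\ forall i, (i <= n)%N -> is_prime_ideal (c i),
      forall i, (i < n)%N -> strict_subset (c i) (c i.+1)
    & c n = P].

Definition prime_height P : enat :=
  esup (fun a => exists n c, prime_chain_to P n c /\ a = Some n).

Definition height I : enat :=
  einf (fun a => exists P,
    [/\ is_prime_ideal P, {subset I <= P} & a = prime_height P]).

Definition is_minimal_prime I P : Prop :=
  [/\ is_prime_ideal P, {subset I <= P}
    & forall Q, is_prime_ideal Q -> {subset I <= Q} -> {subset Q <= P} ->
        {subset P <= Q}].

Definition Min I : Type := {P : {pred R} | is_minimal_prime I P}.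

Definition dual_graph I : rel (Min I) :=
  fun P Q : Min I => `[< P <> Q /\
    height (ideal_add (sval P) (sval Q)) = esucc (height I) >].

Definition diam I : enat := diameter (@dual_graph I).

Definition Hirsch I : Prop := ele (diam I) (height I).

(* Read on the given generators: their number is the height of the ideal. *)
Definition complete_intersection s : Prop :=
  height (ideal_gen s) = Some (size s).

Definition divides (a b : R) : Prop := exists c, b = c * a.

Definition is_gcd (a b d : R) : Prop :=
  [/\ divides d a, divides d b
    & forall h, divides h a -> divides h b -> divides h d].

End Ideals.

(* Main.v *)
Require Import Defs.
From HB Require Import structures.
From mathcomp Require Import all_boot all_order all_algebra.
From mathcomp Require classical_sets cardinality.
From mathcomp Require Import mpoly.
From mathcomp Require Import ring_quotient boolp.

(** Geometrically, the minimal primes of [I = (f, g)] are the irreducible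
    components of the curve [f = g = 0] in projective 3-space, and two of them are
    adjacent when they meet: the sum of their ideals then lies in a prime strictly
    below the irrelevant ideal, and such a prime has height at most 3.

    Since [g] is a product of linear forms, each component lies on a plane
    [l i = 0], where it is an irreducible component of the plane curve cut out by
    [f]. Let [p] and [q] be components on planes [L] and [M]. A curve and a plane in
    3-space meet, so [p] has a point on [M]. This point satisfies [f = 0] and is in
    [M], hence lies on some component [z] contained in [M]. So [p] and [z] meet, and
    [z] and [q] meet because two curves in a plane do. The distance from [p] to [q]
    is at most 2, which is the height of [I] by the hypothesis of complete
    intersection.

    The algebra behind this has three parts.

    - Polynomial rings over a field are factorial ([factorial_mpoly]). Applied to
      the coordinate ring of a plane, this shows that every component on the plane
      [l = 0] has an ideal [(l, h)] with [h] homogeneous, and that such a component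
      passes through each point of the plane where [f] vanishes
      ([prime_over_plane_curve]).

    - A chain of primes in a polynomial ring in [n] variables has length at most
      [n] ([prime_chain_length]). This bounds the height of the primes below the
      irrelevant ideal ([relevant_height]) and proves that the ideals [(l, h)] above
      are minimal over [I] ([chain_minimal]).

    - Fewer forms of positive degree than there are variables have a common zero in
      projective space ([homog_common_prime]). This provides the intersection
      points.

    The last two are proved by growth estimates, that is by comparing dimensions of
    spaces of polynomials through [card_free_le]. *)

Set Implicit Arguments.
Unset Strict Implicit.
Unset Printing Implicit Defensive.

Import GRing.Theory.
Local Open Scope ring_scope.

(** * Prime ideals *)

Section PrimeIdeals.
Variable R : comNzRingType.
Implicit Types (P Q : {pred R}) (x y : R).

Lemma prime_ideal0 P : is_prime_ideal P -> 0 \in P.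
Proof. by case=> [[]]. Qed.

Lemma prime_ideal1 P : is_prime_ideal P -> 1 \notin P.
Proof. by case=> [[]]. Qed.

Lemma prime_idealD P x y : is_prime_ideal P -> x \in P -> y \in P -> x + y \in P.
Proof. by case=> [[_ _ PD] _] Px Py; rewrite -[x]mul1r PD. Qed.

Lemma prime_idealMl P x y : is_prime_ideal P -> y \in P -> x * y \in P.
Proof. by case=> [[P0 _ PD] _] Py; rewrite -[_ * _]addr0 PD. Qed.

Lemma prime_idealMr P x y : is_prime_ideal P -> x \in P -> x * y \in P.
Proof. by move=> Pp Px; rewrite mulrC prime_idealMl. Qed.

Lemma prime_idealB P x y : is_prime_ideal P -> x \in P -> y \in P -> x - y \in P.
Proof.
by move=> Pp Px Py; rewrite prime_idealD // -mulN1r prime_idealMl.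
Qed.

Lemma prime_ideal_sum P I (r : seq I) (C : pred I) (F : I -> R) :
  is_prime_ideal P -> (forall i, C i -> F i \in P) ->
  \sum_(i <- r | C i) F i \in P.
Proof.
move=> Pp PF; elim/big_rec: _ => [|i x Ci Px]; first exact: prime_ideal0.
by rewrite prime_idealD // PF.
Qed.

Lemma prime_idealM P x y :
  is_prime_ideal P -> (x * y \in P) = (x \in P) || (y \in P).
Proof.
move=> Pp; apply/idP/orP => [xyP|[xP|yP]].
- by apply/orP; case: Pp => _; apply.
- by rewrite prime_idealMr.
by rewrite prime_idealMl.
Qed.

Lemma prime_ideal_prod P I (r : seq I) (F : I -> R) :
  is_prime_ideal P -> \prod_(i <- r) F i \in P -> exists i, F i \in P.
Proof.
move=> Pp; elim: r => [|i r IH].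
  by rewrite big_nil (negPf (prime_ideal1 Pp)).
by rewrite big_cons prime_idealM // => /orP[|/IH //]; exists i.
Qed.

(** Gauss's argument: take the first coefficients of [a] and [b] outside [P];
    in the coefficient of [a * b] at the sum of their degrees every other term
    lies in [P]. This serves twice: for the primality of constant primes in a
    polynomial ring, and for that of homogeneous cores. *)
Lemma coef_prime_ideal P (a b : {poly R}) : is_prime_ideal P ->
  (forall i, (a * b)`_i \in P) ->
  (forall i, a`_i \in P) \/ (forall i, b`_i \in P).
Proof.
move=> Pp abP; have [aP|aNP] := pselect (forall i, a`_i \in P); first by left.
have [bP|bNP] := pselect (forall i, b`_i \in P); first by right.
have exN (c : {poly R}) : ~ (forall i, c`_i \in P) ->
    exists2 i, c`_i \notin P & forall j, (j < i)%N -> c`_j \in P.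
  move=> cNP; have ex : exists i, c`_i \notin P.
    apply: contrapT => nex; apply: cNP => i; apply/negPn/negP => ciN.
    by apply: nex; exists i.
  case: (ex_minnP ex) => i ciN imin; exists i => // j ltji.
  by apply/negPn/negP => /imin; rewrite leqNgt ltji.
have [i aiN amin] := exN _ aNP; have [j bjN bmin] := exN _ bNP.
have := abP (i + j)%N; rewrite coefM.
have lti : (i < (i + j).+1)%N by rewrite ltnS leq_addr.
rewrite (bigD1 (Ordinal lti)) //= addKn => inP.
suff : a`_i * b`_j \in P by rewrite prime_idealM // (negPf aiN) (negPf bjN).
rewrite -[X in X \in P](addrK (\sum_(s < (i + j).+1 | s != Ordinal lti)
   a`_s * b`_(i + j - s))) prime_idealB //.
apply: prime_ideal_sum => // s neqs.
case: (ltngtP s i) => [ltsi|ltis|eqsi].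
- by rewrite prime_idealMr // amin.
- rewrite prime_idealMl // bmin // ltn_subLR ?ltn_add2r //.
  by rewrite -ltnS ltn_ord.
by case/eqP: neqs; apply: val_inj.
Qed.

End PrimeIdeals.

(** * Unique factorization in polynomial rings *)

Lemma divides_refl (R : comNzRingType) (a : R) : divides a a.
Proof. by exists 1; rewrite mul1r. Qed.

Lemma divides_trans (R : comNzRingType) (b a c : R) :
  divides a b -> divides b c -> divides a c.
Proof. by move=> [x ->] [y ->]; exists (y * x); rewrite mulrA. Qed.

Lemma divides_mull (R : comNzRingType) (a b : R) : divides a (b * a).
Proof. by exists b. Qed.

Lemma divides_mulr (R : comNzRingType) (a b : R) : divides a (a * b).
Proof. by exists b; rewrite mulrC. Qed.

Section Factorial.

Definition prime_elt (R : comNzRingType) (p : R) : Prop :=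
  [/\ p != 0, ~ divides p 1
    & forall x y, divides p (x * y) -> divides p x \/ divides p y].

Definition multiples (R : comNzRingType) (p : R) : {pred R} :=
  [pred x | `[< divides p x >]].

(** The factors are required to be prime, not only irreducible, so that the
    existence of factorizations already contains their uniqueness. *)
Definition factorial_domain (R : idomainType) : Prop :=
  forall a : R, a != 0 -> exists (u : R) (s : seq R),
    [/\ divides u 1, forall p, p \in s -> prime_elt p
      & a = u * \prod_(p <- s) p].

Lemma multiplesP (R : comNzRingType) (p x : R) :
  reflect (divides p x) (x \in multiples p).
Proof. exact: asboolP. Qed.

Lemma multiples_prime (R : comNzRingType) (p : R) :
  prime_elt p -> is_prime_ideal (multiples p).
Proof.
move=> [_ pN1 pM]; split=> [|x y /multiplesP /pM[]]; first split.
- by apply/multiplesP; exists 0; rewrite mul0r.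
- by apply/negP => /multiplesP.
- move=> a x y /multiplesP[c ->] /multiplesP[d ->].
  by apply/multiplesP; exists (a * c + d); rewrite mulrDl mulrA.
- by move=> /multiplesP ->.
by move=> /multiplesP ->; rewrite orbT.
Qed.

Variable R : idomainType.
Implicit Types (p a b c : R) (f g : {poly R}).

Lemma divides_polyC p f : divides p%:P f <-> forall i, divides p f`_i.
Proof.
split=> [[q ->] i|pf]; first by rewrite coefMC; exact: divides_mull.
have /choice[c cE] := pf.
exists (\poly_(i < size f) c i); apply/polyP => i; rewrite coefMC coef_poly.
by case: ltnP => [_|/leq_sizeP -> //]; rewrite -?cE ?mul0r.
Qed.

Lemma prime_elt_polyC p : prime_elt p -> prime_elt p%:P.
Proof.
move=> pp; have [p0 p1 _] := pp; split; first by rewrite polyC_eq0.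
  by move=> /divides_polyC /(_ 0); rewrite coefC.
move=> f g /divides_polyC pfg.
have [i|pf|pg] := coef_prime_ideal (a := f) (b := g) (multiples_prime pp).
- exact/multiplesP.
- by left; apply/divides_polyC => i; apply/multiplesP.
by right; apply/divides_polyC => i; apply/multiplesP.
Qed.

(** Over a factorial domain: the content of [f] is a unit. *)
Definition primitive f : Prop := forall p, prime_elt p -> ~ divides p%:P f.

Lemma primitive_dvd f g : divides g f -> primitive f -> primitive g.
Proof. by move=> gf pf p pp pg; apply: (pf p pp); apply: divides_trans gf. Qed.

Hypothesis facR : factorial_domain R.

(** The prime factors of [a] can be cancelled one at a time: they remain prime
    as constants and do not divide [f], so they divide the cofactor. *)
Lemma primitive_cancel f g a : primitive f -> a != 0 ->
  divides f (a%:P * g) -> divides f g.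
Proof.
move=> pf a0; have [u [s [[v uv] ps ->]]] := facR a0.
elim: s g ps => [|p s IH] g ps.
  rewrite big_nil mulr1 => -[q qE]; exists (v%:P * q).
  by rewrite -mulrA -qE mulrA -polyCM -uv mul1r.
rewrite big_cons mulrCA polyCM -mulrA => -[q qE].
have pp : prime_elt p by apply: ps; rewrite mem_head.
have [pp0 _ ppM] := prime_elt_polyC pp.
have /ppM[[q' q'E]|/pf//] : divides p%:P (q * f) by rewrite -qE; exact: divides_mulr.
apply: IH => [r rs|]; first by apply: ps; rewrite inE rs orbT.
exists q'; apply: (mulfI pp0); rewrite qE q'E; by rewrite mulrAC mulrC.
Qed.

(** A constant prime that divides [f] divides its leading coefficient, and
    dividing by it removes one of the finitely many prime factors there. *)
Lemma primitive_part f : f != 0 ->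
  exists c g, [/\ c != 0, f = c%:P * g & primitive g].
Proof.
move=> f0; have lf0 : lead_coef f != 0 by rewrite lead_coef_eq0.
have [u [s [u1 ps lfE]]] := facR lf0.
have [n] := ubnP (size s); elim: n => // n IH in u s f f0 lf0 u1 ps lfE * => sn.
have [pf|npf] := pselect (primitive f).
  by exists 1, f; rewrite oner_neq0 mul1r.
have [p [pp [g gE]]] : exists p, prime_elt p /\ divides p%:P f.
  apply: contrapT => nex; apply: npf => p pp pf.
  by apply: nex; exists p.
have [p0 pN1 pM] := pp.
have g0 : g != 0 by apply: contra_neq f0; rewrite gE => ->; rewrite mul0r.
have lgE : lead_coef f = lead_coef g * p by rewrite gE lead_coefM lead_coefC.
have [q [qs [v vE]]] : exists q, q \in s /\ divides p q.
  have : \prod_(q <- s) q \in multiples p.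
    have: lead_coef f \in multiples p.
      by apply/multiplesP; rewrite lgE; exact: divides_mull.
    rewrite lfE (prime_idealM _ _ (multiples_prime pp)) // => /orP[/multiplesP pu|//].
    by case: pN1; apply: divides_trans u1.
  elim: (s) => [|r t IHt].
    by rewrite big_nil (negPf (prime_ideal1 (multiples_prime pp))).
  rewrite big_cons (prime_idealM _ _ (multiples_prime pp)) //.
  case/orP => [/multiplesP pr|/IHt[q [qt pq]]].
    by exists r; rewrite mem_head.
  by exists q; rewrite inE qt orbT.
have v1 : divides v 1.
  have [q0 qN1 qM] := ps _ qs.
  have /qM[[w wE]|[w wE]] : divides q (v * p) by rewrite -vE; exact: divides_refl.
    case: pN1; exists (w); apply: (mulfI q0).
    by rewrite mulr1 {1}vE wE mulrAC mulrC.
  exists w; apply: (mulfI p0).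
  by rewrite mulr1 {1}wE vE mulrA mulrC.
have lgE' : lead_coef g = (u * v) * \prod_(r <- rem q s) r.
  apply: (mulIf p0); rewrite -lgE lfE (perm_big _ (perm_to_rem qs)) big_cons /= {1}vE.
  by rewrite -!mulrA [p * _]mulrC.
have uv1 : divides (u * v) 1.
  have [[x xE] [y yE]] := (u1, v1); exists (x * y).
  by rewrite mulrACA -xE -yE mulr1.
have [||||c [h [c0 gE' ph]]] := IH (u * v) (rem q s) g _ _ uv1 _ lgE' _.
- exact: g0.
- by rewrite lead_coef_eq0.
- by move=> r /mem_rem; exact: ps.
- by rewrite size_rem // -ltnS prednK //; case: (s) qs.
exists (p * c), h; split=> //; first by rewrite mulf_neq0.
by rewrite gE gE' polyCM mulrC mulrA.
Qed.

Lemma primitive_const_unit c : c != 0 -> primitive c%:P -> divides c 1.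
Proof.
move=> c0 pc; have [u [[|p s] [u1 ps cE]]] := facR c0.
  by rewrite cE big_nil mulr1.
have pp : prime_elt p by apply: ps; rewrite mem_head.
case: (pc p pp); rewrite cE big_cons mulrCA polyCM; exact: divides_mulr.
Qed.

(** Euclid's argument with pseudo-division. If [g] divides [a * b], an element
    [r] of least degree in the ideal [(g, a)] divides constant multiples of [g]
    and of [a], so its primitive part divides both. Either that part is
    nonconstant, then it is [g] up to a unit and [g] divides [a]; or [r] is a
    constant, and [g] divides a constant multiple of [b]. *)
Lemma primitive_irreducible_prime g : primitive g -> (1 < size g)%N ->
  (forall h, divides h g -> (1 < size h)%N -> (size g <= size h)%N) ->
  prime_elt g.
Proof.
move=> pg sg gmin; have g0 : g != 0 by rewrite -size_poly_gt0 ltnW.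
split=> // [[q qE]|a b gab].
  have := sg; have : size (q * g) = 1%N by rewrite -qE size_poly1.
  have q0 : q != 0 by apply: contra_eq_neq qE => ->; rewrite mul0r oner_neq0.
  rewrite size_mul // => szE sg'.
  have : (0 < size q)%N by rewrite size_poly_gt0.
  by case: (size q) szE => // n; rewrite addSn /= => szE; rewrite -szE in sg';
    rewrite ltnNge leq_addl in sg'.
(* r is a nonzero element of least size in the ideal (g, a). *)
pose inI r := `[< exists u v, r = u * g + v * a >].
have exI : exists n, `[< exists r, [/\ r != 0, inI r & size r = n] >].
  exists (size g); apply/asboolP; exists g; split=> //.
  by apply/asboolP; exists 1, 0; rewrite mul1r mul0r addr0.
case: (ex_minnP exI) => n /asboolP[r [r0 /asboolP[u [v rE]] szr]] rmin.
have dvd_r x : inI x -> exists2 c, c != 0 & divides r (c%:P * x).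
  move=> /asboolP[u' [v' xE]].
  have := Pdiv.Idomain.divp_eq x r; set c := _ ^+ _; set q := _ %/ _.
  move=> eqx; have c0 : c != 0 by rewrite expf_neq0 // lead_coef_eq0.
  exists c => //; exists q; rewrite mul_polyC eqx.
  have [-> //|rem0] := eqVneq (x %% r) 0; first by rewrite addr0.
  have := ltn_modp x r; rewrite r0 szr ltnNge rmin //.
  apply/asboolP; exists (x %% r); split=> //; apply/asboolP.
  have -> : x %% r = c *: x - q * r by rewrite eqx addrC addKr.
  exists (c%:P * u' - q * u), (c%:P * v' - q * v).
  rewrite xE rE -mul_polyC !mulrDr !mulrBl !mulrA opprD !addrA.
  by rewrite -!addrA; congr (_ + _); rewrite addrCA.
have [c1 c10 rg] : exists2 c, c != 0 & divides r (c%:P * g).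
  by apply: dvd_r; apply/asboolP; exists 1, 0; rewrite mul1r mul0r addr0.
have [c2 c20 ra] : exists2 c, c != 0 & divides r (c%:P * a).
  by apply: dvd_r; apply/asboolP; exists 0, 1; rewrite mul1r mul0r add0r.
have [c [r' [c0 rE' pr']]] := primitive_part r0.
have r'r : divides r' r by rewrite rE'; exact: divides_mull.
have r'g : divides r' g by apply: primitive_cancel c10 _ => //; apply: divides_trans rg.
have r'a : divides r' a by apply: primitive_cancel c20 _ => //; apply: divides_trans ra.
have r'0 : r' != 0 by apply: contra_neq r0; rewrite rE' => ->; rewrite mulr0.
case: (ltnP 1 (size r')) => [sr'|sr'].
  left; apply: divides_trans r'a; have [w wE] := r'g.
  have w0 : w != 0 by apply: contra_neq g0; rewrite wE => ->; rewrite mul0r.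
  have := gmin _ r'g sr'; rewrite {1}wE size_mul // => szw.
  have w1 : (size w <= 1)%N.
    move: szw sr'; case: (size w) => [//|m]; rewrite addSn /=.
    by case: m => // m; rewrite addSn ltnNge leq_addl.
  have /size_poly1P[d d0 wd] : size w == 1%N by rewrite eqn_leq w1 size_poly_gt0.
  have [|e eE] := primitive_const_unit d0.
    by apply: primitive_dvd pg; rewrite -wd wE; exact: divides_mulr.
  by exists e%:P; rewrite wE wd mulrA -polyCM -eE mul1r.
right; have [d d0 r'd] : exists2 d, d != 0 & r' = d%:P.
  by apply/size_poly1P; rewrite eqn_leq sr' size_poly_gt0.
apply: (primitive_cancel pg (mulf_neq0 c0 d0)).
have -> : (c * d)%:P * b = u * g * b + v * (a * b).
  by rewrite polyCM -r'd -rE' rE mulrDl mulrA.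
have [w ->] := gab; exists (u * b + v * w).
by rewrite mulrDl mulrA mulrAC.
Qed.

Lemma factorial_poly : factorial_domain {poly R}.
Proof.
have prim f : f != 0 -> primitive f -> exists (u : {poly R}) (s : seq {poly R}),
    [/\ divides u 1, forall q, q \in s -> prime_elt q & f = u * \prod_(q <- s) q].
  have [n] := ubnP (size f); elim: n => // n IH in f * => szf f0 pf.
  case: (ltnP 1 (size f)) => sf; last first.
    have [d d0 fd] : exists2 d, d != 0 & f = d%:P.
      by apply/size_poly1P; rewrite eqn_leq sf size_poly_gt0.
    exists f, [::]; split=> //; last by rewrite big_nil mulr1.
    have [|e eE] := primitive_const_unit d0; first by rewrite -fd.
    by exists e%:P; rewrite fd -polyCM -eE.
  (* A nonconstant divisor of least degree is prime. *)
  have exg : exists m, `[< exists g, [/\ divides g f, (1 < size g)%N & size g = m] >].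
    by exists (size f); apply/asboolP; exists f; split=> //; exact: divides_refl.
  case: (ex_minnP exg) => m /asboolP[g [gf sg szg]] gmin.
  have pg : prime_elt g.
    apply: primitive_irreducible_prime => //; first exact: primitive_dvd pf.
    move=> h hg sh; rewrite szg; apply: gmin; apply/asboolP; exists h.
    by split=> //; apply: divides_trans gf.
  have [w wE] := gf.
  have w0 : w != 0 by apply: contra_neq f0; rewrite wE => ->; rewrite mul0r.
  have g0 : g != 0 by case: pg.
  have [|||u [s [u1 ps wE']]] := IH w => //.
  - rewrite -ltnS (leq_trans _ szf) // wE size_mul //.
    move: sg; case: (size g) => [|[|k]] // _; rewrite !addnS /= !ltnS.
    exact: leq_addr.
  - by apply: primitive_dvd pf; rewrite wE; exact: divides_mulr.
  exists u, (g :: s); split=> //.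
    by move=> p; rewrite inE => /orP[/eqP -> //|]; exact: ps.
  by rewrite big_cons wE wE' mulrAC -mulrA; congr (_ * _); rewrite mulrC.
move=> f f0; have [c [g [c0 fE pg]]] := primitive_part f0.
have g0 : g != 0 by apply: contra_neq f0; rewrite fE => ->; rewrite mulr0.
have [u [s [[v u1] ps gE]]] := prim g g0 pg.
have [u' [s' [[v' u'1] ps' cE]]] := facR c0.
exists (u'%:P * u), ([seq p%:P | p <- s'] ++ s); split.
- by exists (v'%:P * v); rewrite mulrACA -polyCM -u'1 -u1 mulr1.
- move=> p; rewrite mem_cat => /orP[/mapP[q qs ->]|/ps //].
  by apply: prime_elt_polyC; apply: ps'.
by rewrite fE gE cE big_cat big_map /= polyCM rmorph_prod /= mulrACA.
Qed.

End Factorial.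

Lemma mpoly_ring_ind (n : nat) (R : comNzRingType) (C : {mpoly R[n]} -> Prop) :
  (forall c, C c%:MP) -> (forall i, C 'X_i) ->
  (forall a b, C a -> C b -> C (a + b)) ->
  (forall a b, C a -> C b -> C (a * b)) ->
  forall a, C a.
Proof.
move=> CC CX CD CM a; rewrite (mpolyE a).
elim/big_ind: _ => [| |m _]; [by rewrite -(mpolyC0 n); exact: CC|exact: CD|].
rewrite -mul_mpolyC; apply: (CM) => //; rewrite mpolyXE_id.
elim/big_ind: _ => [| |i _]; [by rewrite -(mpolyC1 n); exact: CC|exact: CM|].
by elim: (m i) => [|e IH]; rewrite ?expr0 ?exprS; [rewrite -(mpolyC1 n)|apply: CM].
Qed.

Lemma factorial_transport (R R' : idomainType) (phi : {rmorphism R -> R'})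
    (psi : R' -> R) :
  cancel phi psi -> cancel psi phi -> factorial_domain R' -> factorial_domain R.
Proof.
move=> phiK psiK facR' a a0.
have dvd_psi x y : divides (phi x) (phi y) -> divides x y.
  move=> [c cE]; exists (psi c); apply: (can_inj phiK).
  by rewrite rmorphM psiK.
have dvd_phi x y : divides x y -> divides (phi x) (phi y).
  by move=> [c ->]; exists (phi c); rewrite rmorphM.
have /facR'[u [s [u1 ps aE]]] : phi a != 0.
  by apply: contra_neq a0 => a0; rewrite -(phiK a) a0 -(rmorph0 phi) phiK.
exists (psi u), (map psi s); split.
- by apply: dvd_psi; rewrite psiK rmorph1.
- move=> _ /mapP[p /ps [p0 pN1 pM] ->]; split.
  + by apply: contra_neq p0 => p0; rewrite -(psiK p) p0 rmorph0.
  + by move/dvd_phi; rewrite psiK rmorph1.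
  move=> x y /dvd_phi; rewrite psiK rmorphM => /pM.
  by case=> ?; [left|right]; apply: dvd_psi; rewrite psiK.
apply: (can_inj phiK); rewrite rmorphM psiK aE rmorph_prod big_map.
by congr (_ * _); apply: eq_bigr => p _; rewrite psiK.
Qed.

Lemma factorial_mpoly (k : fieldType) (n : nat) : factorial_domain {mpoly k[n]}.
Proof.
elim: n => [|n IHn].
  move=> a a0; exists a, [::]; split=> //; last by rewrite big_nil mulr1.
  have [c aE] : exists c, a = c%:MP.
    by exists a@_0; exact: nvar0_mpolyC.
  have c0 : c != 0 by apply: contra_neq a0; rewrite aE => ->.
  by exists (c^-1)%:MP; rewrite aE -mpolyCM mulVf.
have [psi [psiD psiM psiX psiC]] : exists psi : {poly {mpoly k[n]}} -> {mpoly k[n.+1]},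
    [/\ {morph psi : p q / p + q}, {morph psi : p q / p * q},
        psi 'X = 'X_ord_max & forall c, psi c%:P = mwiden c].
  exists (fun p => (map_poly (@mwiden n k) p).['X_ord_max]); split=> [p q|p q||c].
  - by rewrite rmorphD hornerD.
  - by rewrite rmorphM hornerM.
  - by rewrite map_polyX hornerX.
  by rewrite map_polyC hornerC.
have psi0 : psi 0 = 0 by rewrite -polyC0 psiC mwiden0.
have mwidenX i : mwiden ('X_i : {mpoly k[n]}) = 'X_(widen_ord (leqnSn n) i).
  by rewrite /mwiden mmapX mmap1U.
have muniX i : muni ('X_(widen_ord (leqnSn n) i) : {mpoly k[n.+1]}) = ('X_i)%:P.
  rewrite /muni mmapX mmap1U; case: splitP => [j /= ij|j /= ij].
    by congr ('X__)%:P; apply: val_inj.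
  by have := ltn_ord i; rewrite ij ord1 addn0 ltnn.
have muniXmax : muni ('X_ord_max : {mpoly k[n.+1]}) = 'X.
  rewrite /muni mmapX mmap1U; case: splitP => [j /= nj|//].
  by have := ltn_ord j; rewrite -nj ltnn.
have muniK : cancel (@muni n k) psi.
  elim/mpoly_ring_ind=> [c|i|a b|a b].
  - by rewrite muniC psiC mwidenC.
  - case: (ltnP i n) => [ltin|lein].
      have -> : i = widen_ord (leqnSn n) (Ordinal ltin) by apply: val_inj.
      by rewrite muniX psiC mwidenX.
    have -> : i = ord_max by apply: val_inj; apply/eqP; rewrite eqn_leq lein leq_ord.
    by rewrite muniXmax psiX.
  - by move=> aE bE; rewrite muniD psiD; exact: (congr2 +%R aE bE).
  by move=> aE bE; rewrite muniM psiM; exact: (congr2 *%R aE bE).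
have mwidenK (c : {mpoly k[n]}) : muni (mwiden c) = c%:P.
  move: c; apply: mpoly_ring_ind => [c|i|a b aE bE|a b aE bE].
  - by rewrite mwidenC muniC.
  - by rewrite mwidenX muniX.
  - by rewrite mwidenD muniD polyCD; exact: (congr2 +%R aE bE).
  by rewrite mwidenM muniM polyCM; exact: (congr2 *%R aE bE).
have psiK : cancel psi (@muni n k).
  elim/poly_ind=> [|p c IHp]; first by rewrite psi0 muni0.
  by rewrite psiD psiM muniD muniM IHp psiX psiC muniXmax mwidenK.
exact: factorial_transport muniK psiK (factorial_poly IHn).
Qed.

(** * Lengths of chains of primes in a polynomial ring *)

Lemma card_free_le (k : fieldType) (V : lmodType k) (T U : finType)
    (v : T -> V) (w : U -> V) :
  (forall t, exists c : U -> k, v t = \sum_u c u *: w u) ->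
  (forall c : T -> k, \sum_t c t *: v t = 0 -> forall t, c t = 0) ->
  (#|T| <= #|U|)%N.
Proof.
move=> /choice[a vE] vfree; rewrite leqNgt; apply/negP => ltUT.
pose A := \matrix_(i < #|T|, j < #|U|) a (enum_val i) (enum_val j).
have : kermx A != 0.
  by rewrite -mxrank_eq0 mxrank_ker subn_eq0 -ltnNge (leq_ltn_trans (rank_leq_col A)).
case/rowV0Pn => x /sub_kermxP xA0 /eqP; apply.
pose c t := x 0 (enum_rank t).
suff c0 t : c t = 0.
  by apply/rowP => i; rewrite mxE -[i]enum_valK; exact: c0.
apply: vfree t; under eq_bigr do rewrite vE scaler_sumr.
rewrite exchange_big big1 //= => u _; under eq_bigr do rewrite scalerA.
rewrite -scaler_suml -[RHS](scale0r (w u)); congr (_ *: _).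
have /rowP/(_ (enum_rank u)) := xA0; rewrite !mxE => xAu; rewrite -[RHS]xAu.
rewrite (reindex _ (onW_bij _ (@enum_val_bij T))) /=.
by apply: eq_bigr => i _; rewrite /c enum_valK !mxE !enum_rankK.
Qed.

Lemma card_bmnm_le (n b : nat) : (#|{: 'X_{1..n < b}}| <= b ^ n)%N.
Proof.
have ltb (m : 'X_{1..n < b}) i : (m i < b)%N.
  by apply: leq_ltn_trans (bmdeg m); rewrite mdegE (bigD1 i) //= leq_addr.
rewrite -[X in (_ <= X ^ _)%N]card_ord -[X in (_ <= _ ^ X)%N]card_ord -card_ffun.
apply: (leq_card (fun m => [ffun i => Ordinal (ltb m i)])) => m m' /ffunP eqm.
by apply/val_inj/mnmP => i; have := eqm i; rewrite !ffunE => -[].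
Qed.

Lemma prime_chain_shift (R : comNzRingType) (P : {pred R}) m c :
  prime_chain_to P m.+1 c -> prime_chain_to P m (fun i => c i.+1).
Proof. by case=> cp cs cm; split=> // i lei; [exact: cp|exact: cs]. Qed.

Section Growth.
Variables (k : fieldType) (n : nat).
Local Notation S := {mpoly k[n]}.

(** Linear independence over [k] in the quotient by [P]. *)
Definition free_mod (P : {pred S}) (T : finType) (v : T -> S) : Prop :=
  forall c : T -> k, \sum_t c t *: v t \in P -> forall t, c t = 0.

Lemma prime_idealZ (P : {pred S}) (c : k) x :
  is_prime_ideal P -> x \in P -> c *: x \in P.
Proof. by move=> Pp xP; rewrite -mul_mpolyC prime_idealMl. Qed.

(** The part of degree [0] in [b] of a relation modulo [P] is a relation modulo
    [Q], hence trivial; what remains is divisible by [b], which can be cancelled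
    modulo the prime [P]. *)
Lemma free_mod_powers (P Q : {pred S}) (b : S) (T : finType) (v : T -> S) N :
  is_prime_ideal P -> is_prime_ideal Q -> {subset P <= Q} ->
  b \in Q -> b \notin P -> free_mod Q v ->
  free_mod P (fun ti : T * 'I_N => v ti.1 * b ^+ ti.2).
Proof.
move=> Pp Qp PQ bQ bP vfree c cP.
have {}cP : \sum_(i < N) \sum_t c (t, i) *: (v t * b ^+ i) \in P.
  rewrite exchange_big pair_big; congr (_ \in P): cP.
  by apply: eq_bigr => -[].
case=> t i; move: c cP t i; elim: N => [|N IH] c cP t i; first by case: i.
have sumE : \sum_(i < N.+1) \sum_t c (t, i) *: (v t * b ^+ i) =
    \sum_t c (t, ord0) *: v t +
    b * \sum_(i < N) \sum_t c (t, lift ord0 i) *: (v t * b ^+ i).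
  rewrite big_ord_recl; congr (_ + _).
    by apply: eq_bigr => u _; rewrite expr0 mulr1.
  rewrite mulr_sumr; apply: eq_bigr => j _; rewrite mulr_sumr.
  by apply: eq_bigr => u _; rewrite exprS mulrCA scalerAr.
have c0 u : c (u, ord0) = 0.
  apply: (vfree (fun t => c (t, ord0))).
  have := PQ _ cP; rewrite sumE; set r := (X in b * X) => sQ.
  by have := prime_idealB Qp sQ (prime_idealMr r Qp bQ); rewrite addrK.
have {}cP : \sum_(i < N) \sum_t c (t, lift ord0 i) *: (v t * b ^+ i) \in P.
  move: cP; rewrite sumE big1 ?add0r => [|u _]; last by rewrite c0 scale0r.
  by rewrite prime_idealM // (negPf bP).
have [j ->|->] := unliftP ord0 i; last exact: c0.
exact: (IH (fun ti => c (ti.1, lift ord0 ti.2))).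
Qed.

Lemma msizeM_pred_le (p q : S) : (msize (p * q) <= (msize p + msize q).-1)%N.
Proof.
have [->|p0] := eqVneq p 0; first by rewrite mul0r msize0.
have [->|q0] := eqVneq q 0; first by rewrite mulr0 msize0.
by rewrite msizeM.
Qed.

Lemma msize_expr_le (b : S) i : (msize (b ^+ i) <= (i * msize b).+1)%N.
Proof.
elim: i => [|i IH]; first by rewrite expr0 msize1.
rewrite exprS (leq_trans (msizeM_pred_le _ _)) //.
by rewrite -subn1 leq_subLR add1n mulSn -!addnS leq_add2l leqW.
Qed.

(** Every step of the chain contributes an element [b], and the monomials in
    these elements with exponents below [N] stay independent modulo the bottom
    of the chain: the quotient has transcendence degree at least [m], in a form
    that needs only finite families. *)
Lemma prime_chain_free (P : {pred S}) m c : prime_chain_to P m c ->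
  exists D, forall N, exists (T : finType) (v : T -> S),
    [/\ #|T| = (N ^ m)%N, forall t, (msize (v t) <= (D * N).+1)%N
      & free_mod (c 0%N) v].
Proof.
elim: m c => [|m IH] c cP.
  exists 0%N => N; exists unit, (fun=> 1); split=> [|_|a].
  - by rewrite card_unit.
  - by rewrite msize1.
  have [/(_ 0%N isT) Pp _ _] := cP.
  rewrite (big_pred1 tt) => [aP|[]//] [].
  apply: contraNeq (prime_ideal1 Pp) => a0.
  by rewrite -[1](scalerK a0) prime_idealZ.
have [D DP] := IH _ (prime_chain_shift cP).
have [cp /(_ 0%N isT)[sub01 nsub] _] := cP.
have [b [b1 b0]] : exists b, b \in c 1%N /\ b \notin c 0%N.
  apply: contrapT => nex; apply: nsub => b b1.
  by apply/negPn/negP => b0; apply: nex; exists b.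
exists (D + msize b)%N => N; have [T [v [cardT szv vfree]]] := DP N.
exists (T * 'I_N)%type, (fun ti : T * 'I_N => v ti.1 * b ^+ ti.2); split=> [|[t i]|] /=.
- by rewrite card_prod card_ord cardT expnSr.
- rewrite (leq_trans (msizeM_pred_le _ _)) //.
  apply: (@leq_trans ((D * N).+1 + (i * msize b).+1).-1).
    by rewrite -!subn1 leq_sub2r // leq_add // msize_expr_le.
  by rewrite addSn addnS ltnS mulnDl leq_add2l mulnC leq_mul2l ltnW ?orbT.
by apply: free_mod_powers vfree => //; apply: cp.
Qed.

(** The Krull dimension of a polynomial ring, by growth: a chain of length [m]
    yields [N ^ m] independent polynomials of degree [O(N)], in a space of
    dimension [O(N ^ n)]. *)
Lemma prime_chain_length (P : {pred S}) m c : prime_chain_to P m c -> (m <= n)%N.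
Proof.
move=> cP; have [D DP] := prime_chain_free cP.
rewrite leqNgt; apply/negP => ltnm.
(* N ^ n.+1 exceeds (D.+1 * N) ^ n, which bounds the dimension. *)
pose N := (D.+1 ^ n).+1; have [T [v [cardT szv vfree]]] := DP N.
have : (#|T| <= #|{: 'X_{1..n < (D * N).+1}}|)%N.
  pose w (mu : 'X_{1..n < (D * N).+1}) : S := 'X_[mu].
  apply: (card_free_le (v := v) (w := w)) => [t|a a0].
    by exists (fun m : 'X_{1..n < (D * N).+1} => (v t)@_m); rewrite -mpolywE.
  by apply: vfree; rewrite a0 prime_ideal0 //; case: cP => cp _ _; apply: cp.
move/leq_trans/(_ (card_bmnm_le _ _)); rewrite cardT leqNgt => /negP; apply.
apply: (@leq_ltn_trans ((D.+1 * N) ^ n)).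
  have ltDN : ((D * N).+1 <= D.+1 * N)%N by rewrite mulSn addnC -addn1 leq_add.
  by case: (n) => // n'; rewrite leq_exp2r.
rewrite expnMn (@leq_trans (N ^ n.+1)) ?leq_pexp2l //.
by rewrite expnS ltn_pmul2r // expn_gt0.
Qed.

End Growth.

(** * Homogeneous cores of primes *)

Lemma mcoeff_sum (n : nat) (R : nzRingType) m I (r : seq I) (C : pred I)
    (F : I -> {mpoly R[n]}) :
  (\sum_(i <- r | C i) F i)@_m = \sum_(i <- r | C i) (F i)@_m.
Proof. exact: raddf_sum. Qed.

Lemma mcoeff0M (n : nat) (R : nzRingType) (p q : {mpoly R[n]}) :
  (p * q)@_0%MM = p@_0%MM * q@_0%MM.
Proof. exact: (mcoeff0_is_multiplicative n R).1. Qed.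

Section HomogeneousCore.
Variables (k : fieldType) (n : nat).
Local Notation S := {mpoly k[n]}.
Implicit Types (a b : S) (P : {pred S}).

Lemma mcoeff_pihomog a d m :
  (pihomog mdeg d a)@_m = if mdeg m == d then a@_m else 0.
Proof.
rewrite pihomogE mcoeff_sum; case: eqP => [md|md]; last first.
  rewrite big1 // => m' /eqP m'd; rewrite mcoeffZ mcoeffX.
  by case: eqP => [eqm|]; rewrite ?mulr0 //; case: md; rewrite -eqm.
rewrite [in RHS](mpolyE a) mcoeff_sum [LHS]big_mkcond /=; apply: eq_bigr => m' _.
case: eqP => // m'd; rewrite mcoeffZ mcoeffX.
by case: eqP => [eqm|]; rewrite ?mulr0 //; case: m'd; rewrite eqm.
Qed.

(** The substitution of ['X_i * T] for ['X_i]: a ring morphism whose coefficient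
    at [T ^+ d] is the component of degree [d]. *)
Definition homog_expansion : S -> {poly S} :=
  mmap (polyC \o @mpolyC n k) (fun i => ('X_i)%:P * 'X).

Lemma coef_homog_expansion a d : (homog_expansion a)`_d = pihomog mdeg d a.
Proof.
rewrite /homog_expansion /mmap coef_sum pihomogE [RHS]big_mkcond /=.
apply: eq_bigr => m _.
have -> : mmap1 (fun i => ('X_i)%:P * 'X) m = ('X_[m] : S)%:P * 'X^(mdeg m).
  rewrite /mmap1; under eq_bigr do rewrite exprMn.
  rewrite big_split /= prodrXr -mdegE mpolyXE_id rmorph_prod; congr (_ * _).
  by apply: eq_bigr => i _; rewrite rmorphXn.
rewrite mulrA -polyCM mul_mpolyC coefCM coefXn [d == _]eq_sym.
by case: eqP; rewrite ?mulr1 ?mulr0.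
Qed.

Lemma homog_expansionM : {morph homog_expansion : a b / a * b}.
Proof. by move=> a b; rewrite /homog_expansion rmorphM. Qed.

Lemma pihomogM d a b : pihomog mdeg d (a * b) =
  \sum_(i < d.+1) pihomog mdeg i a * pihomog mdeg (d - i) b.
Proof.
rewrite -coef_homog_expansion homog_expansionM coefM.
apply: eq_bigr => i _.
exact: (congr2 *%R (coef_homog_expansion _ _) (coef_homog_expansion _ _)).
Qed.

Lemma pihomogM_homog d e a b : b \is e.-homog ->
  pihomog mdeg d (a * b) =
    if (e <= d)%N then pihomog mdeg (d - e) a * b else 0.
Proof.
move=> be; rewrite pihomogM; case: leqP => [led|ltd].
  have ltde : (d - e < d.+1)%N by rewrite ltnS leq_subr.
  rewrite (bigD1 (Ordinal ltde)) //= subKn // (pihomog_dE be) big1 ?addr0 //.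
  move=> i neqi; rewrite (pihomog_ne0 _ be) ?mulr0 //.
  apply: contra_neq neqi => eqe; apply: val_inj => /=.
  by rewrite eqe subKn // -ltnS.
rewrite big1 // => i _; rewrite (pihomog_ne0 _ be) ?mulr0 //.
by rewrite gtn_eqF // (leq_ltn_trans (leq_subr _ _)).
Qed.

(** The largest homogeneous ideal inside [P]. *)
Definition homog_core P : {pred S} :=
  [pred a | `[< forall d, pihomog mdeg d a \in P >]].

Lemma homog_coreP P a :
  reflect (forall d, pihomog mdeg d a \in P) (a \in homog_core P).
Proof. exact: asboolP. Qed.

Lemma homog_core_sub P : is_prime_ideal P -> {subset homog_core P <= P}.
Proof.
move=> Pp a /homog_coreP aP.
rewrite (pihomog_partitionE (leqnn (mmeasure mdeg a))).
exact: prime_ideal_sum.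
Qed.

Lemma homog_core_homog P a d : is_prime_ideal P ->
  a \is d.-homog -> a \in P -> a \in homog_core P.
Proof.
move=> Pp ad aP; apply/homog_coreP => e; have [<-|ne] := eqVneq d e.
  by rewrite pihomog_dE.
by rewrite (pihomog_ne0 ne) // prime_ideal0.
Qed.

(** Membership in the core is a condition on the coefficients of
    [homog_expansion a], and this expansion is multiplicative. *)
Lemma homog_core_prime P : is_prime_ideal P -> is_prime_ideal (homog_core P).
Proof.
move=> Pp; split=> [|a b /homog_coreP abP]; first split.
- by apply/homog_coreP => d; rewrite pihomog0 prime_ideal0.
- apply/negP => /homog_coreP/(_ 0%N).
  by rewrite pihomog_dE ?dhomog1 // (negPf (prime_ideal1 Pp)).
- move=> a u v /homog_coreP uP /homog_coreP vP; apply/homog_coreP => d.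
  rewrite pihomogD prime_idealD // pihomogM prime_ideal_sum // => i _.
  by rewrite prime_idealMl.
have [|aP|bP] := coef_prime_ideal (a := homog_expansion a)
                   (b := homog_expansion b) Pp.
- by move=> i; rewrite -homog_expansionM coef_homog_expansion.
- by apply/orP; left; apply/homog_coreP => d; rewrite -coef_homog_expansion.
by apply/orP; right; apply/homog_coreP => d; rewrite -coef_homog_expansion.
Qed.

Definition irrelevant_ideal : {pred S} := [pred a | a@_0%MM == 0].

Lemma irrelevant_prime : is_prime_ideal irrelevant_ideal.
Proof.
split=> [|a b]; first split.
- by rewrite inE mcoeff0.
- by rewrite inE mcoeff1 eqxx oner_neq0.
- move=> a u v; rewrite !inE mcoeffD mcoeff0M => /eqP -> /eqP ->.
  by rewrite mulr0 addr0.
by rewrite !inE mcoeff0M mulf_eq0.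
Qed.

Lemma homog_irrelevant a d : (0 < d)%N -> a \is d.-homog -> a \in irrelevant_ideal.
Proof.
move=> d0 /dhomog_nemf_coeff ad; apply/eqP/ad.
by rewrite mf0 eq_sym -lt0n.
Qed.

Lemma homog_core_irrelevant P :
  is_prime_ideal P -> {subset homog_core P <= irrelevant_ideal}.
Proof.
move=> Pp a /homog_coreP/(_ 0%N) a0P; rewrite inE.
apply: contraNT (prime_ideal1 Pp) => a0.
have a0E : pihomog mdeg 0 a = (a@_0%MM)%:MP.
  apply/mpolyP => m; rewrite mcoeff_pihomog mcoeffC mdeg_eq0.
  by case: eqP => [->|]; rewrite ?mulr1 ?mulr0.
have -> : 1 = (a@_0%MM)^-1 *: pihomog mdeg 0 a.
  by rewrite a0E -mul_mpolyC -mpolyCM mulVf // mpolyC1.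
exact: prime_idealZ.
Qed.

End HomogeneousCore.

(** By Zorn's lemma there is a largest ideal that contains [J] and no power of
    [x]. It is prime: if it misses [a] and [b], adding either of them brings in a
    power of [x], and the product of the two powers lies in it as soon as [a * b]
    does. *)
Lemma prime_avoiding (R : comNzRingType) (J : {pred R}) (x : R) :
  0 \in J -> (forall a, {in J &, forall u v, a * u + v \in J}) ->
  (forall n, x ^+ n \notin J) ->
  exists P, [/\ is_prime_ideal P, {subset J <= P} & x \notin P].
Proof.
move=> J0 JD Jx.
pose good (A : classical_sets.set R) := [/\ forall a, J a -> A a,
  forall a u v, A u -> A v -> A (a * u + v) & forall n, ~ A (x ^+ n)].
(* The empty set is admitted as the union of the empty chain. *)
pose C (A : classical_sets.set R) := (forall a, ~ A a) \/ good A.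
have [|A [CA Amax]] := @classical_sets.Zorn_bigcup R C.
  move=> F FC totF.
  have [[A0 [FA0 [a0 A0a0]]]|nF] := pselect (exists A, F A /\ exists a, A a); last first.
    by left=> a [A FA Aa]; apply: nF; exists A; split=> //; exists a.
  right; split.
  - move=> a Ja; exists A0 => //.
    by case: (FC _ FA0) => [/(_ _ A0a0)//|[JA _ _]]; apply: JA.
  - move=> a u v [A FA Au] [B FB Bv].
    have [AB|BA] := totF _ _ FA FB.
      exists B => //; case: (FC _ FB) => [/(_ _ Bv)//|[_ BD _]].
      by apply: BD => //; apply: AB.
    exists A => //; case: (FC _ FA) => [/(_ _ Au)//|[_ AD _]].
    by apply: AD => //; apply: BA.
  move=> m [A FA Ax]; case: (FC _ FA) => [/(_ _ Ax)//|[_ _ nAx]].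
  exact: nAx Ax.
have gA : good A.
  case: CA => // nA; case: (Amax (fun a => J a)).
    by split=> [a /nA//|/(_ 0 J0)/nA].
  by right; split=> [//|a u v|m]; [exact: JD|apply/negP; exact: Jx].
have [JA AD nAx] := gA.
have A0 : A 0 by apply: JA.
have AM a u : A u -> A (a * u) by move=> Au; rewrite -[_ * _]addr0; apply: AD.
have grow a : ~ A a -> exists m u r, A u /\ x ^+ m = r * a + u.
  move=> nAa; apply: contrapT => nex.
  pose B : classical_sets.set R := fun b => exists u r, A u /\ b = r * a + u.
  apply: (Amax B).
    split=> [b Ab|BA]; first by exists b, 0; rewrite mul0r add0r.
    by apply: nAa; apply: BA; exists 0, 1; rewrite mul1r addr0.
  right; split.
  - by move=> b /JA Ab; exists b, 0; rewrite mul0r add0r.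
  - move=> b _ _ [u [r [Au ->]]] [v [s [Av ->]]].
    exists (b * u + v), (b * r + s); split; first exact: AD.
    by rewrite mulrDr mulrDl !mulrA addrACA.
  by move=> m [u [r [Au xE]]]; apply: nex; exists m, u, r.
exists ([pred a | `[< A a >]] : {pred R}); split.
- split; first split.
  + exact/asboolP.
  + by apply/asboolP; rewrite -(expr0 x).
  + by move=> a u v /asboolP Au /asboolP Av; apply/asboolP; apply: AD.
  move=> a b /asboolP Aab; apply/orP.
  have [Aa|/grow[i [u [r [Au xiE]]]]] := pselect (A a); first by left; apply/asboolP.
  have [Ab|/grow[j [v [s [Av xjE]]]]] := pselect (A b); first by right; apply/asboolP.
  case: (nAx (i + j)%N); rewrite exprD xjE mulrDr.
  have -> : x ^+ i * (s * b) = (r * s) * (a * b) + (s * b) * u.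
    by rewrite xiE mulrDl mulrACA [u * _]mulrC.
  by rewrite -addrA; apply: (AD); last (apply: (AD)=> //; exact: AM).
- by move=> a Ja; apply/asboolP; apply: JA.
by apply/asboolP; rewrite -[x]expr1.
Qed.

(** * Common zeros of fewer forms than variables *)

Section Span.
Variables (k : fieldType) (V : lmodType k) (U : finType) (w : U -> V).

Definition in_span (x : V) : Prop := exists c : U -> k, x = \sum_u c u *: w u.

Lemma in_span_mem u : in_span (w u).
Proof.
exists (fun u' => (u' == u)%:R); rewrite (bigD1 u) //= eqxx scale1r.
by rewrite big1 ?addr0 // => u' /negPf ->; rewrite scale0r.
Qed.

Lemma in_span0 : in_span 0.
Proof. by exists (fun=> 0); rewrite big1 // => u _; rewrite scale0r. Qed.

Lemma in_spanZ a x : in_span x -> in_span (a *: x).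
Proof.
move=> [c ->]; exists (fun u => a * c u); rewrite scaler_sumr.
by apply: eq_bigr => u _; rewrite scalerA.
Qed.

Lemma in_spanD x y : in_span x -> in_span y -> in_span (x + y).
Proof.
move=> [c ->] [d ->]; exists (fun u => c u + d u); rewrite -big_split /=.
by apply: eq_bigr => u _; rewrite scalerDl.
Qed.

Lemma in_span_sum I (r : seq I) (C : pred I) (F : I -> V) :
  (forall i, C i -> in_span (F i)) -> in_span (\sum_(i <- r | C i) F i).
Proof.
by move=> CF; elim/big_ind: _ => //; [exact: in_span0|exact: in_spanD].
Qed.

End Span.

Section CommonPoint.
Variables (k : fieldType) (n m : nat).
Local Notation S := {mpoly k[n]}.
Variables (h : 'I_m -> S) (e : 'I_m -> nat).
Hypothesis e_gt0 : forall i, (0 < e i)%N.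
Hypothesis h_homog : forall i, h i \is (e i).-homog.

Definition generated (x : S) : Prop := exists r : 'I_m -> S, x = \sum_i r i * h i.

Lemma generated0 : generated 0.
Proof. by exists (fun=> 0); rewrite big1 // => i _; rewrite mul0r. Qed.

Lemma generatedP a x y : generated x -> generated y -> generated (a * x + y).
Proof.
move=> [r ->] [s ->]; exists (fun i => a * r i + s i).
rewrite mulr_sumr -big_split; apply: eq_bigr => i _.
by rewrite mulrDl mulrA.
Qed.

Lemma generatedM a x : generated x -> generated (a * x).
Proof.
by move=> gx; rewrite -[_ * _]addr0; apply: generatedP => //; exact: generated0.
Qed.

(** When all monomials of degree at least [B] lie in the ideal of the [h i],
    these products span the polynomials of degree at most [D] over [k]. *)
Definition gen_monomial (B D : nat)
    (t : {ffun 'I_m -> 'I_D.+1} * 'X_{1..n < B}) : S :=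
  (\prod_i h i ^+ t.1 i) * 'X_[t.2].

Lemma gen_monomialM B D t i : in_span (@gen_monomial B D.+1) (@gen_monomial B D t * h i).
Proof.
have ltD (j : 'I_m) : (t.1 j + (j == i) < D.+2)%N.
  by have := ltn_ord (t.1 j); case: (_ == _) => /= ?; rewrite ?addn1 ?addn0 // ltnW.
suff -> : gen_monomial t * h i =
    gen_monomial (D := D.+1) ([ffun j => Ordinal (ltD j)], t.2) by exact: in_span_mem.
rewrite /gen_monomial /= mulrAC; congr (_ * _).
rewrite (bigD1 i) //= [in RHS](bigD1 i) //= ffunE /= eqxx addn1 exprSr mulrAC.
congr (_ * _); apply: eq_bigr => j /negPf neq.
by rewrite ffunE /= neq addn0.
Qed.

(** Induction on the degree: a monomial of degree at least [B] is a sum of terms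
    [r i * h i] in which, after taking components, [r i] is homogeneous of smaller
    degree because [h i] has positive degree. *)
Lemma homog_in_span B :
  (forall mu, (B <= mdeg mu)%N -> generated 'X_[mu]) ->
  forall d D a, (d <= D)%N -> a \is d.-homog -> in_span (@gen_monomial B D) a.
Proof.
move=> genB d; elim/ltn_ind: d => d IH D a ledD ad.
rewrite (mpolyE a) big_seq; apply: in_span_sum => mu /(dhomog_mf ad) mud.
apply: in_spanZ; case: (ltnP d B) => [ltdB|leBd].
  have ltB : (mdeg mu < B)%N by rewrite mud.
  suff -> : 'X_[mu] = gen_monomial (D := D) ([ffun=> ord0], BMultinom ltB) :> S.
    exact: in_span_mem.
  by rewrite /gen_monomial big1 ?mul1r // => i _; rewrite ffunE expr0.
have [|r xE] := genB mu; first by rewrite mud.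
have -> : 'X_[mu] = pihomog mdeg d ('X_[mu] : S).
  by rewrite pihomog_dE // dhomogX mud.
rewrite xE raddf_sum /=; apply: in_span_sum => i _.
rewrite (pihomogM_homog _ _ (h_homog i)); case: leqP => [leed|_]; last first.
  exact: in_span0.
have d0 : (0 < d)%N by apply: leq_trans leed.
case: D ledD => [|D] ledD; first by move: d0; rewrite ltnNge ledD.
have ltd : (d - e i < d)%N by rewrite ltn_subrL e_gt0.
have [||c ->] := IH (d - e i)%N ltd D (pihomog mdeg (d - e i) (r i)).
- by rewrite -ltnS (leq_trans ltd).
- exact: pihomogP.
rewrite mulr_suml; apply: in_span_sum => t _; rewrite -scalerAl.
by apply: in_spanZ; exact: gen_monomialM.
Qed.

Hypothesis lt_mn : (m < n)%N.

(** Otherwise the polynomial ring is finite over the subring generated by the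
    [h i], so that it grows too slowly: the [N ^ n] monomials with exponents below
    [N] would lie in a space of dimension [O(N ^ m)]. *)
Lemma exists_high_monomial B : exists mu, (B <= mdeg mu)%N /\ ~ generated 'X_[mu].
Proof.
apply: contrapT => nex.
have genB mu : (B <= mdeg mu)%N -> generated 'X_[mu].
  by move=> lemu; apply: contrapT => ngen; apply: nex; exists mu.
(* N ^ m.+1 exceeds (n.+1 * N) ^ m * B ^ n, which bounds the dimension. *)
pose N := (n.+1 ^ m * B ^ n).+1.
pose T := {ffun 'I_n -> 'I_N}.
pose mon (t : T) : 'X_{1..n} := [multinom val (t i) | i < n].
have mdeg_mon t : (mdeg (mon t) <= n * N)%N.
  rewrite mdegE -[X in (_ <= X * _)%N]card_ord -sum_nat_const.
  by apply: leq_sum => i _; rewrite mnmE; exact/ltnW/ltn_ord.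
have : (#|T| <= #|{: {ffun 'I_m -> 'I_(n * N).+1} * 'X_{1..n < B}}|)%N.
  apply: (card_free_le (v := fun t0 : T => 'X_[mon t0] : S)
                       (w := @gen_monomial B (n * N))) => [t|c c0 t].
  - by apply: (homog_in_span genB (mdeg_mon t)); rewrite dhomogX.
  - have := congr1 (mcoeff (mon t)) c0; rewrite mcoeff_sum mcoeff0 (bigD1 t) //=.
    rewrite mcoeffZ mcoeffX eqxx mulr1 big1 ?addr0 // => t' neqt.
    rewrite mcoeffZ mcoeffX; case: eqP => [eqm|_]; last by rewrite mulr0.
    case/eqP: neqt; apply/ffunP => i; apply: val_inj.
    by have := congr1 (fun mu : 'X_{1..n} => mu i) eqm; rewrite /mon !mnmE.
rewrite card_prod !card_ffun !card_ord leqNgt => /negP; apply.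
apply: (@leq_ltn_trans ((n.+1 * N) ^ m * B ^ n)).
  rewrite leq_mul ?card_bmnm_le //.
  have leN : ((n * N).+1 <= n.+1 * N)%N by rewrite mulSn addnC -addn1 leq_add.
  by case: (m) => // m'; rewrite leq_exp2r.
rewrite expnMn mulnAC (@leq_trans (N ^ m.+1)) ?leq_pexp2l //.
by rewrite expnS ltn_pmul2r // expn_gt0.
Qed.

Lemma exists_variable_avoiding : exists i : 'I_n, forall E, ~ generated ('X_i ^+ E).
Proof.
apply: contrapT => nex.
have /choice[E EP] : forall i : 'I_n, exists E, generated ('X_i ^+ E).
  move=> i; apply: contrapT => nE; apply: nex; exists i => E gE.
  by apply: nE; exists E.
have [mu [lemu []]] := exists_high_monomial (\sum_i E i).+1.
have [i leE] : exists i, (E i <= mu i)%N.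
  apply: contrapT => nE; move: lemu; rewrite ltnNge => /negP; apply.
  rewrite mdegE; apply: leq_sum => i _; rewrite leqNgt; apply/negP => ltE.
  by apply: nE; exists i; rewrite ltnW.
have leU : (U_(i) *+ E i <= mu)%MM.
  apply/mnm_lepP => j; rewrite mulmnE mnm1E; case: eqP => [<-|_].
    by rewrite mul1n.
  by rewrite mul0n.
by rewrite -(submK leU) mpolyXD -mpolyXn; apply: generatedM.
Qed.

(** Fewer forms than variables have a common zero in projective space. A prime
    that contains the forms and avoids some variable exists since no power of
    this variable lies in their ideal; its homogeneous core still contains the
    forms, and is below the irrelevant ideal. *)
Theorem homog_common_prime : exists P : {pred S},
  [/\ is_prime_ideal P, forall i, h i \in P, {subset P <= @irrelevant_ideal k n}
    & exists i : 'I_n, 'X_i \notin P].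
Proof.
have [i iP] := exists_variable_avoiding.
have [||E|P [Pp JP xP]] := @prime_avoiding S [pred x | `[< generated x >]] 'X_i.
- exact/asboolP/generated0.
- by move=> a u v /asboolP gu /asboolP gv; apply/asboolP/generatedP.
- by apply/asboolPn/iP.
exists (homog_core P); split=> [|j||].
- exact: homog_core_prime.
- apply: (homog_core_homog Pp (h_homog j)); apply: JP; apply/asboolP.
  exists (fun j' => (j' == j)%:R); rewrite (bigD1 j) //= eqxx mul1r big1 ?addr0 //.
  by move=> j' /negPf ->; rewrite mul0r.
- exact: homog_core_irrelevant.
exists i; apply: contra xP; exact: homog_core_sub.
Qed.

End CommonPoint.

(** * Plane curves as prime ideals *)

Lemma linear_formE (k : fieldType) (n : nat) (l : {mpoly k[n]}) :
  l \is 1.-homog -> l = \sum_i l@_U_(i) *: 'X_i.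
Proof.
move=> l1; apply/mpolyP => m; rewrite mcoeff_sum.
have [/eqP|m1] := eqVneq (mdeg m) 1%N; last first.
  rewrite (dhomog_nemf_coeff l1 m1) big1 // => i _; rewrite mcoeffZ mcoeffX.
  by case: eqP => [eqm|]; rewrite ?mulr0 //; case/eqP: m1; rewrite -eqm mdeg1.
rewrite mdeg_eq1 => /existsP[j /eqP ->].
rewrite (bigD1 j) //= mcoeffZ mcoeffX eqxx mulr1 big1 ?addr0 // => i neq.
by rewrite mcoeffZ mcoeffXU (negPf neq) mulr0.
Qed.

Lemma msize_mmap_linear (k : fieldType) (n m : nat) (h : 'I_n -> {mpoly k[m]}) a :
  (forall i, msize (h i) <= 2)%N ->
  (msize (mmap (@mpolyC m k) h a) <= msize a)%N.
Proof.
move=> szh; rewrite /mmap big_seq (leq_trans (msize_sum _ _ _)) //.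
apply/bigmax_leqP_seq => mu mua _; apply: leq_trans (msize_mdeg_lt mua).
rewrite mul_mpolyC (leq_trans (msizeZ_le _ _)) // /mmap1 mdegE.
elim/big_rec2: _ => [|i d x _ IH]; first by rewrite msize1.
rewrite (leq_trans (msizeM_pred_le _ _)) //.
have : (msize (h i ^+ mu i) <= (mu i).+1)%N; last first.
  by move=> szX; rewrite -subn1 leq_subLR add1n -addnS -addSn leq_add.
elim: (mu i) => [|e IHe]; first by rewrite expr0 msize1.
rewrite exprS (leq_trans (msizeM_pred_le _ _)) //.
by rewrite -subn1 leq_subLR add1n -[e.+3]/(2 + e.+1)%N leq_add.
Qed.

(** The quotient by a nonzero linear form is a polynomial ring in one variable
    less: [phi] solves [l = 0] for a variable that occurs in [l], and [sigma]
    includes the polynomials in the other variables. *)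
Lemma linear_form_elimination (k : fieldType) (n : nat) (l : {mpoly k[n.+1]}) :
  l \is 1.-homog -> l != 0 ->
  exists (phi : {rmorphism {mpoly k[n.+1]} -> {mpoly k[n]}})
         (sigma : {rmorphism {mpoly k[n]} -> {mpoly k[n.+1]}}),
  [/\ cancel sigma phi, phi l = 0, forall a, divides l (a - sigma (phi a)),
      forall a, (msize (phi a) <= msize a)%N
    & forall a, (msize (sigma a) <= msize a)%N].
Proof.
move=> l1 l0; have lE := linear_formE l1.
have [j lj0] : exists j, l@_U_(j) != 0.
  apply: contrapT => nex; case/eqP: l0; rewrite lE big1 // => i _.
  have [->|li0] := eqVneq (l@_U_(i)) 0; first by rewrite scale0r.
  by case: nex; exists i.
set c := l@_U_(j) in lj0.
pose y : {mpoly k[n]} := - (c^-1 *: \sum_i l@_U_(lift j i) *: 'X_i).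
pose X i : {mpoly k[n]} := if unlift j i is Some i' then 'X_i' else y.
pose Y (i : 'I_n) : {mpoly k[n.+1]} := 'X_(lift j i).
pose phi : {rmorphism {mpoly k[n.+1]} -> {mpoly k[n]}} := mmap (@mpolyC n k) X.
pose sigma : {rmorphism {mpoly k[n]} -> {mpoly k[n.+1]}} :=
  mmap (@mpolyC n.+1 k) Y.
have phiC a : phi a%:MP = a%:MP by rewrite /phi /= mmapC.
have sigmaC a : sigma a%:MP = a%:MP by rewrite /sigma /= mmapC.
have phiX i : phi 'X_(lift j i) = 'X_i by rewrite /phi /= mmapX mmap1U /X liftK.
have phiXj : phi 'X_j = y by rewrite /phi /= mmapX mmap1U /X unlift_none.
have sigmaX i : sigma 'X_i = 'X_(lift j i) by rewrite /sigma /= mmapX mmap1U.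
have phiZ a x : phi (a *: x) = a *: phi x.
  by rewrite -!mul_mpolyC rmorphM phiC.
have sigmaZ a x : sigma (a *: x) = a *: sigma x.
  by rewrite -!mul_mpolyC rmorphM sigmaC.
have szphi a : (msize (phi a) <= msize a)%N.
  apply: msize_mmap_linear => i; rewrite /X; case: unliftP => [i' _|_].
    by rewrite msizeX mdeg1.
  rewrite /y msizeN (leq_trans (msizeZ_le _ _)) // (leq_trans (msize_sum _ _ _)) //.
  apply/bigmax_leqP => i' _; rewrite (leq_trans (msizeZ_le _ _)) //.
  by rewrite msizeX mdeg1.
have szsigma a : (msize (sigma a) <= msize a)%N.
  by apply: msize_mmap_linear => i; rewrite msizeX mdeg1.
clearbody phi sigma; exists phi, sigma; split=> //.
- apply: mpoly_ring_ind => [a|i|a b aE bE|a b aE bE].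
  + by rewrite sigmaC phiC.
  + by rewrite sigmaX phiX.
  + by rewrite !rmorphD /= aE bE.
  by rewrite !rmorphM /= aE bE.
- rewrite lE (bigD1_ord j) //= rmorphD rmorph_sum phiZ phiXj /= -/c /y.
  rewrite scalerN scalerA divff // scale1r addrC; apply/eqP; rewrite subr_eq0.
  by apply/eqP/eq_bigr => i _; rewrite phiZ phiX.
apply: mpoly_ring_ind => [a|i|a b [x xE] [y' yE]|a b [x xE] [y' yE]].
- by exists 0; rewrite phiC sigmaC subrr mul0r.
- have [i' ->|->] := unliftP j i.
    by exists 0; rewrite phiX sigmaX subrr mul0r.
  exists (c^-1)%:MP; rewrite mul_mpolyC phiXj /y rmorphN sigmaZ opprK rmorph_sum.
  rewrite [in RHS]lE (bigD1_ord j) //= -/c scalerDr scalerA mulVf // scale1r.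
  by congr (_ + _ *: _); apply: eq_bigr => i' _; rewrite sigmaZ sigmaX.
- exists (x + y'); rewrite mulrDl -xE -yE !rmorphD /= opprD addrACA.
  by [].
exists (a * y' + x * sigma (phi b)).
rewrite mulrDl -[a * y' * l]mulrA [x * _ * l]mulrAC -yE -xE !rmorphM /=.
by rewrite mulrBr mulrBl addrA subrK.
Qed.

Lemma homog_msize_le (k : fieldType) (n d : nat) (a : {mpoly k[n]}) :
  a \is d.-homog -> (msize a <= d.+1)%N.
Proof.
move=> ad; rewrite msizeE; apply/bigmax_leqP_seq => m ma _.
by rewrite (dhomog_mf ad ma).
Qed.

Lemma pihomog_lt_msize (k : fieldType) (n d : nat) (a : {mpoly k[n]}) :
  pihomog mdeg d a != 0 -> (d < msize a)%N.
Proof.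
apply: contraNT; rewrite -leqNgt => lead; apply/eqP/mpolyP => m.
rewrite mcoeff_pihomog mcoeff0; case: eqP => // md.
by apply: memN_msupp_eq0; apply: msize_mdeg_ge; rewrite md.
Qed.

Lemma prime_ideal_preim (R R' : comNzRingType) (phi : {rmorphism R -> R'})
    (P : {pred R'}) :
  is_prime_ideal P -> is_prime_ideal ([pred a | phi a \in P] : {pred R}).
Proof.
move=> Pp; split=> [|a b]; first split.
- by rewrite inE rmorph0 prime_ideal0.
- by rewrite inE rmorph1 prime_ideal1.
- move=> a u v; rewrite !inE => uP vP.
  by rewrite rmorphD rmorphM prime_idealD // prime_idealMl.
by rewrite !inE rmorphM prime_idealM.
Qed.

Lemma factorial_prime_elt (R : idomainType) (P : {pred R}) a :
  factorial_domain R -> is_prime_ideal P -> a != 0 -> a \in P ->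
  exists p, [/\ prime_elt p, p \in P & divides p a].
Proof.
move=> facR Pp a0; have [u [s [u1 ps ->]]] := facR a a0.
rewrite prime_idealM // => /orP[uP|].
  case: u1 => v vE; have := prime_ideal1 Pp.
  by rewrite vE prime_idealMl.
elim: s ps => [|p s IH] ps; first by rewrite big_nil (negPf (prime_ideal1 Pp)).
have pp : prime_elt p by apply: ps; rewrite mem_head.
rewrite big_cons prime_idealM // => /orP[pP|sP].
  exists p; split=> //; rewrite mulrCA; exact: divides_mulr.
have [|//|q [qp qP [c cE]]] := IH; first by move=> q qs; apply: ps; rewrite inE qs orbT.
exists q; split=> //; rewrite mulrCA cE; exists (p * c); exact: mulrA.
Qed.

Lemma prime_elt_assoc (R : idomainType) (p q : R) :
  prime_elt p -> prime_elt q -> divides p q -> divides q p.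
Proof.
move=> [p0 pN1 _] [q0 _ qM] [c cE].
have /qM[[d dE]|//] : divides q (c * p) by rewrite -cE; exact: divides_refl.
case: pN1; exists d; apply: (mulfI q0).
by rewrite mulr1 {1}cE dE mulrAC mulrC.
Qed.

(** On the plane [l = 0] the equation [f = 0] decomposes into irreducible
    factors, and one of them, [p], vanishes at [P]. The ideal [Q] of the
    polynomials divisible by [p] on the plane is prime and generated by [l] and
    [sigma p]. The second generator can be made homogeneous: the core of [Q] is
    again a prime that contains [l] and [f], so it contains some prime factor of
    [f] on the plane, which [p] divides and is thus associated to; hence [Q] is
    homogeneous. A component [h] of [sigma p] that does not vanish on the plane is
    then a multiple of [p] there, of degree at most that of [p], so it differs
    from [p] by a scalar. *)
Lemma prime_over_plane_curve (k : fieldType) (n df : nat)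
    (l f : {mpoly k[n.+1]}) (P : {pred {mpoly k[n.+1]}}) :
  l \is 1.-homog -> f \is df.-homog -> l != 0 -> ~ divides l f ->
  is_prime_ideal P -> l \in P -> f \in P ->
  exists (Q : {pred {mpoly k[n.+1]}}) (h : {mpoly k[n.+1]}) (e : nat),
  [/\ is_prime_ideal Q, {subset Q <= P}, l \in Q & f \in Q] /\
  [/\ (0 < e)%N, h \is e.-homog, h \in Q
    & forall a, a \in Q -> exists x y, a = x * l + y * h].
Proof.
move=> l1 fd l0 nlf Pp lP fP.
have [phi [sigma [sigmaK phil phiK szphi szsigma]]] := linear_form_elimination l1 l0.
have phif0 : phi f != 0.
  apply/eqP => phif0; apply: nlf; have := phiK f.
  by rewrite phif0 rmorph0 subr0.
have trans (T : {pred {mpoly k[n.+1]}}) a : is_prime_ideal T -> l \in T ->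
    (sigma (phi a) \in T) = (a \in T).
  move=> Tp lT; have [c cE] := phiK a.
  have -> : sigma (phi a) = a - c * l by rewrite -cE subKr.
  have clT : c * l \in T by rewrite prime_idealMl.
  apply/idP/idP => [aT|aT]; last by rewrite prime_idealB.
  by rewrite -(subrK (c * l) a) prime_idealD.
have prime_factor (T : {pred {mpoly k[n.+1]}}) : is_prime_ideal T ->
    l \in T -> f \in T ->
    exists p, [/\ prime_elt p, sigma p \in T & divides p (phi f)].
  move=> Tp lT fT.
  apply: (factorial_prime_elt (@factorial_mpoly k n)
            (prime_ideal_preim sigma Tp) phif0).
  by rewrite inE trans.
have [p [pp pP pf]] := prime_factor P Pp lP fP.
pose Q : {pred {mpoly k[n.+1]}} := [pred a | phi a \in multiples p].
have QP a : reflect (divides p (phi a)) (a \in Q) by exact: multiplesP.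
have Qp : is_prime_ideal Q by exact/prime_ideal_preim/multiples_prime.
have lQ : l \in Q by apply/QP; rewrite phil; exists 0; rewrite mul0r.
have fQ : f \in Q by apply/QP.
have cQp := homog_core_prime Qp.
(* Q is homogeneous: any prime factor of f found in the core generates Q. *)
have sigmap_core : sigma p \in homog_core Q.
  have lcQ := homog_core_homog Qp l1 lQ.
  have [q [qp qQ _]] := prime_factor _ cQp lcQ (homog_core_homog Qp fd fQ).
  have pq : divides p q.
    by rewrite -(sigmaK q); apply/QP; exact: (homog_core_sub Qp).
  have [c ->] := prime_elt_assoc pp qp pq.
  by rewrite rmorphM prime_idealMl.
have p0 : p != 0 by case: pp.
have [d phid0] : exists d, phi (pihomog mdeg d (sigma p)) != 0.
  apply: contrapT => nex; case/eqP: p0; rewrite -(sigmaK p).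
  rewrite (pihomog_partitionE (leqnn (mmeasure mdeg (sigma p)))) rmorph_sum big1 //.
  move=> i _; apply/eqP; apply/negPn/negP => phii0; apply: nex.
  by exists i.
set h := pihomog mdeg d (sigma p) in phid0.
have hd : h \is d.-homog by exact: pihomogP.
have hQ : h \in Q by move/homog_coreP: sigmap_core; apply.
have [r rE] : divides p (phi h) by exact/QP.
have r0 : r != 0 by apply: contra_neq phid0; rewrite rE => ->; rewrite mul0r.
have ltd : (d < msize p)%N.
  apply: leq_trans (szsigma p); apply: pihomog_lt_msize.
  by apply: contra_neq phid0; rewrite -/h => ->; rewrite rmorph0.
have szh : (msize (phi h) <= d.+1)%N.
  exact: leq_trans (szphi h) (homog_msize_le hd).
have r1 : (msize r <= 1)%N.
  have := leq_trans szh ltd; rewrite rE msizeM //.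
  have := p0; rewrite -msize_poly_eq0 -lt0n => szp.
  by case: (msize p) szp => // s _; rewrite addnS -[X in (_ <= X)%N]add1n leq_add2r.
have [c c0 rc] : exists2 c, c != 0 & r = c%:MP.
  by apply/msize_poly1P; rewrite eqn_leq r1 lt0n msize_poly_eq0.
have pE : p = (c^-1)%:MP * phi h.
  by rewrite rE rc mulrA -mpolyCM mulVf // mpolyC1 mul1r.
exists Q, h, d; split; split=> //.
- move=> a /QP[b bE]; rewrite -(trans P a Pp lP) bE rmorphM.
  by rewrite prime_idealMl.
- rewrite lt0n; apply/eqP => d0; case: pp => _ pN1 _; apply: pN1.
  have /msize_poly1P[c' c'0 hc'] : msize (phi h) == 1%N.
    by rewrite eqn_leq {1}d0 in szh *; rewrite szh lt0n msize_poly_eq0.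
  exists ((c')^-1%:MP * r).
  by rewrite -mulrA -rE hc' -mpolyCM mulVf // mpolyC1.
move=> a /QP[b bE].
have [x xE] := phiK a; have [y yE] := phiK h.
pose z := sigma (b * (c^-1)%:MP).
exists (x - z * y), z.
have aE : a = x * l + sigma (phi a) by rewrite -xE subrK.
have hE : sigma (phi h) = h - y * l by rewrite -yE subKr.
rewrite aE bE {1}pE mulrA rmorphM hE -/z mulrBr mulrBl mulrA.
by rewrite -!addrA; congr (_ + _); rewrite addrC.
Qed.

(** * Heights and edges of the dual graph *)

Lemma ele_trans b a c : ele a b -> ele b c -> ele a c.
Proof. by case: a b c => [a|] [b|] [c|] //=; exact: leq_trans. Qed.

Lemma ele_anti a b : ele a b -> ele b a -> a = b.
Proof.
by case: a b => [a|] [b|] //= ab ba; congr Some; apply/eqP; rewrite eqn_leq ab.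
Qed.

Lemma eq_pred_subset (T : Type) (P Q : {pred T}) :
  {subset P <= Q} -> {subset Q <= P} -> P = Q.
Proof. by move=> PQ QP; apply/funext => x; apply/idP/idP => [/PQ|/QP]. Qed.

Section Heights.
Variable R : comNzRingType.
Implicit Types (P Q : {pred R}).

Lemma prime_chain_extend P Q r c :
  prime_chain_to P r c -> is_prime_ideal Q -> strict_subset P Q ->
  exists c', prime_chain_to Q r.+1 c'.
Proof.
move=> [cp cs cP] Qp PQ; exists (fun i => if (i <= r)%N then c i else Q).
split=> [i _|i|]; last by rewrite ltnn.
  by case: ifP => // /cp.
move=> leir; have [ltir|leri] := ltnP i r; first by rewrite -ltnS leir; exact: cs.
have -> : i = r by apply/eqP; rewrite eqn_leq leri -ltnS leir.
by rewrite leqnn cP.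
Qed.

Lemma prime_chain_height P r c : prime_chain_to P r c -> ele (Some r) (prime_height P).
Proof. by move=> cP; apply: esup_ub; exists r, c. Qed.

(** The height is the supremum of the lengths of chains, so that a chain of
    length at least [r] exists although the supremum may be infinite. *)
Lemma height_chain P r : is_prime_ideal P -> ele (Some r) (prime_height P) ->
  exists s c, (r <= s)%N /\ prime_chain_to P s c.
Proof.
case: r => [|r] Pp hP.
  by exists 0%N, (fun=> P); split=> //; split.
apply: contrapT => nex; suff /(ele_trans hP) : ele (prime_height P) (Some r).
  by rewrite /= ltnn.
apply: esup_lub => a [s [c [cP ->]]] /=; rewrite leqNgt; apply/negP => ltrs.
by apply: nex; exists s, c.
Qed.

Lemma ideal_gen2P (f g : R) P : is_prime_ideal P ->
  f \in P -> g \in P -> {subset ideal_gen [:: f; g] <= P}.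
Proof.
move=> Pp fP gP a /asboolP[c ->].
by rewrite big_ord_recl big_ord1 /= prime_idealD // prime_idealMl.
Qed.

Lemma mem_ideal_gen (s : seq R) i : (i < size s)%N -> s`_i \in ideal_gen s.
Proof.
move=> lti; apply/asboolP; exists (fun j => (j == i)%:R).
rewrite (bigD1 (Ordinal lti)) //= eqxx mul1r big1 ?addr0 // => j neq.
suff /negPf -> : (j : nat) != i by rewrite mul0r.
by apply: contra_neq neq => ji; apply: val_inj.
Qed.

End Heights.

Section DualGraph.
Variables (k : fieldType) (n : nat).
Local Notation S := {mpoly k[n.+1]}.
Local Notation mm := (@irrelevant_ideal k n.+1).
Variable I : {pred S}.
Implicit Types P Q : {pred S}.

(** A prime strictly below the irrelevant ideal, a variable witnessing the
    strictness. If homogeneous, it is the ideal of a nonempty subvariety of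
    projective space. *)
Definition relevant P := [/\ is_prime_ideal P, {subset P <= mm}
  & exists i : 'I_n.+1, 'X_i \notin P].

Lemma relevant_strict P : relevant P -> strict_subset P mm.
Proof.
move=> [Pp Pm [i iP]]; split=> // mP; case/negP: iP; apply: mP.
by apply: (@homog_irrelevant _ _ _ 1) => //; rewrite dhomogX /= mdeg1.
Qed.

(** A chain up to [P] can be prolonged by the irrelevant ideal, and no chain has
    length more than [n.+1]. *)
Lemma relevant_height P : relevant P -> ele (prime_height P) (Some n).
Proof.
move=> Prel; apply: esup_lub => a [r [c [cP ->]]] /=.
have [c' cm] := prime_chain_extend cP (@irrelevant_prime k n.+1) (relevant_strict Prel).
exact: prime_chain_length cm.
Qed.

Variable r : nat.
Hypothesis heightI : height I = Some r.

Lemma height_prime P : is_prime_ideal P -> {subset I <= P} ->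
  exists s c, (r <= s)%N /\ prime_chain_to P s c.
Proof.
move=> Pp IP; apply: height_chain => //; rewrite -heightI.
by apply: einf_lb; exists P.
Qed.

(** Two primes, [Q] and the irrelevant ideal, lie above [P]. A prime over [I]
    strictly below [P] has height at least [r], so there would be a chain of
    length [r + 3], which exceeds the dimension [n.+1]. *)
Lemma chain_minimal P : n = r.+1 -> is_prime_ideal P -> {subset I <= P} ->
  (exists2 Q, relevant Q & strict_subset P Q) -> is_minimal_prime I P.
Proof.
move=> nr Pp IP [Q Qrel PQ]; split=> // P' P'p IP' P'P.
apply: contrapT => nPP'.
have [s [c [lers cP']]] := height_prime P'p IP'.
have [c1 cP] := prime_chain_extend cP' Pp (conj P'P nPP').
have [Qp _ _] := Qrel.
have [c2 cQ] := prime_chain_extend cP Qp PQ.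
have [c3 cm] := prime_chain_extend cQ (@irrelevant_prime k n.+1) (relevant_strict Qrel).
by have := prime_chain_length cm; rewrite nr !ltnS ltnNge lers.
Qed.

(** The height of [p + q] is at most that of [P], which is at most [r.+1]. It is
    not smaller: a prime over [p + q] contains [p] strictly, since [p] and [q] are
    distinct minimal primes, and [p] has height at least [r]. *)
Lemma adjacent (p q : Min I) P : n = r.+1 -> p <> q -> relevant P ->
  {subset sval p <= P} -> {subset sval q <= P} -> dual_graph p q.
Proof.
move=> nr neq Prel pP qP; apply/asboolP; split=> //.
case: p q neq pP qP => [p pmin] [q qmin] /= neq pP qP.
have [[pp Ip pm] [qp Iq qm]] := (pmin, qmin).
rewrite heightI /=; apply: ele_anti.
  apply: (@ele_trans (prime_height P)); last by rewrite -nr; exact: relevant_height.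
  have [Pp _ _] := Prel.
  apply: einf_lb; exists P; split=> // x /asboolP[a [b [ap bq ->]]].
  by apply: prime_idealD => //; [exact: pP|exact: qP].
apply: einf_glb => _ [Q [Qp pqQ ->]].
have pQ : {subset p <= Q}.
  move=> x xp; apply: pqQ; apply/asboolP; exists x, 0.
  by rewrite addr0 (prime_ideal0 qp).
have qQ : {subset q <= Q}.
  move=> x xq; apply: pqQ; apply/asboolP; exists 0, x.
  by rewrite add0r (prime_ideal0 pp).
have sQ : strict_subset p Q.
  split=> // Qp'; apply: neq.
  have qp' : {subset q <= p} by move=> x /qQ /Qp'.
  have pq' := pm q qp Iq qp'.
  have epq : p = q by exact: eq_pred_subset.
  by subst q; congr (exist _ _ _); exact: Prop_irrelevance.
have [s [c [lers cp]]] := height_prime pp Ip.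
have [c' cQ] := prime_chain_extend cp Qp sQ.
exact: ele_trans (prime_chain_height cQ).
Qed.

End DualGraph.

(** * Intersections of curves with planes *)

Section Curves.
Variables (k : fieldType) (n : nat).
Local Notation S := {mpoly k[n.+1]}.
Implicit Types (P Q : {pred S}) (l : S).

Lemma common_relevant_prime (s : seq (nat * S)) :
  (size s <= n)%N ->
  (forall x, x \in s -> (0 < x.1)%N /\ x.2 \is x.1.-homog) ->
  exists2 P, relevant P & forall x, x \in s -> x.2 \in P.
Proof.
move=> szs sh; pose x0 := (0%N, 0 : S).
have [|||P [Pp sP Pm iP]] := @homog_common_prime k n.+1 (size s)
  (fun i => (nth x0 s i).2) (fun i => (nth x0 s i).1).
- by move=> i; case: (sh (nth x0 s i)) => //; exact: mem_nth.
- by move=> i; case: (sh (nth x0 s i)) => //; exact: mem_nth.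
- by rewrite ltnS.
exists P => // x /(nthP x0)[i lti <-]; exact: (sP (Ordinal lti)).
Qed.

(** For a prime [Q] in four variables: [Q = (l, h)] is the ideal of an integral
    curve of degree [e] on the plane [l = 0]. *)
Definition curve_on l Q : Prop := exists (h : S) (e : nat),
  [/\ (0 < e)%N, h \is e.-homog, l \in Q, h \in Q
    & forall a, a \in Q -> exists x y, a = x * l + y * h].

Lemma curve_on_sub l Q P h :
  (forall a, a \in Q -> exists x y, a = x * l + y * h) ->
  is_prime_ideal P -> l \in P -> h \in P -> {subset Q <= P}.
Proof.
by move=> Qlh Pp lP hP a /Qlh[x [y ->]]; rewrite prime_idealD // prime_idealMl.
Qed.

Hypothesis n_ge3 : (2 < n)%N.

(** If [Q = (l, h)], the forms [l], [h] and [m] have a common zero. *)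
Lemma curve_meets_form l Q d m : l \is 1.-homog -> curve_on l Q ->
  (0 < d)%N -> m \is d.-homog ->
  exists P, [/\ relevant P, {subset Q <= P} & m \in P].
Proof.
move=> l1 [h [e [e0 he _ _ Qlh]]] d0 md.
have [//|u|P Prel Pin] := @common_relevant_prime [:: (1%N, l); (e, h); (d, m)].
  by rewrite !inE => /or3P[]/eqP -> /=; split.
have [Pp _ _] := Prel.
exists P; split=> //; last by apply: (Pin (d, m)); rewrite !inE eqxx !orbT.
apply: (curve_on_sub Qlh Pp).
  by apply: (Pin (1%N, l)); rewrite !inE eqxx.
by apply: (Pin (e, h)); rewrite !inE eqxx orbT.
Qed.

Lemma curves_on_meet l Q Q' : l \is 1.-homog -> curve_on l Q -> curve_on l Q' ->
  exists P, [/\ relevant P, {subset Q <= P} & {subset Q' <= P}].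
Proof.
move=> l1 Ql [h [e [e0 he lQ' hQ' Q'lh]]].
have [P [Prel QP hP]] := curve_meets_form l1 Ql e0 he.
exists P; split=> //; have [Pp _ _] := Prel.
by apply: (curve_on_sub Q'lh Pp) => //; apply: QP; have [? [? []]] := Ql.
Qed.

(** The curve meets the hyperplane of a variable that does not vanish on it. *)
Lemma curve_not_maximal l Q : l \is 1.-homog -> curve_on l Q ->
  exists2 P, relevant P & strict_subset Q P.
Proof.
move=> l1 Ql.
have [P1 [[_ _ [j jP1]] QP1 _]] := curve_meets_form l1 Ql (ltn0Sn 0) l1.
have Xj1 : ('X_j : S) \is 1.-homog by rewrite dhomogX /= mdeg1.
have [P2 [P2rel QP2 jP2]] := curve_meets_form l1 Ql (ltn0Sn 0) Xj1.
exists P2 => //; split=> // P2Q; case/negP: jP1; apply: QP1; exact: P2Q.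
Qed.

End Curves.

(** * Curves on a union of planes *)

Section ProductOfPlanes.
Variables (k : fieldType) (f g : {mpoly k[4]}) (df e : nat) (l : 'I_e -> {mpoly k[4]}).
Hypothesis f_homog : f \is df.-homog.
Hypothesis l_homog : forall i, l i \is 1.-homog.
Hypothesis g_prod : g = \prod_(i < e) l i.
Hypothesis fg_coprime : is_gcd f g 1.
Local Notation I := (ideal_gen [:: f; g]).
Hypothesis heightI : height I = Some 2.

Lemma minimal_prime_contains_f (p : Min I) : f \in sval p.
Proof.
by have [_ Ip _] := svalP p; apply: Ip; exact: (@mem_ideal_gen _ [:: f; g] 0).
Qed.

Lemma minimal_prime_on_plane (p : Min I) : exists i, l i \in sval p.
Proof.
have [pp Ip _] := svalP p; apply: (prime_ideal_prod (r := index_enum 'I_e) pp).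
by rewrite -g_prod; apply: Ip; exact: (@mem_ideal_gen _ [:: f; g] 1).
Qed.

(** The point [P] of the plane [l i = 0] lies on a component [Q] of the plane
    section of [f = 0]. As [Q] is a curve, there is room above it for a point, and
    this makes it minimal over [I]. *)
Lemma curve_through (P : {pred {mpoly k[4]}}) i :
  is_prime_ideal P -> l i \in P -> f \in P ->
  exists p : Min I, {subset sval p <= P} /\ curve_on (l i) (sval p).
Proof.
move=> Pp lP fP.
have lg : divides (l i) g by rewrite g_prod (bigD1 i) //=; exact: divides_mulr.
have [_ _ gcd1] := fg_coprime.
have not_unit b : b \in P -> ~ divides b 1.
  by move=> bP [c cE]; have := prime_ideal1 Pp; rewrite cE prime_idealMl.
have nlf : ~ divides (l i) f.
  by move=> lf; apply: (not_unit (l i)) => //; exact: gcd1.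
have l0 : l i != 0.
  apply/eqP => l0; apply: (not_unit f) => //; apply: gcd1.
    exact: divides_refl.
  by exists 0; have [c ->] := lg; rewrite l0 mulr0 mul0r.
have [Q [h [c [[Qp QP lQ fQ] [c0 hc hQ Qlh]]]]] :=
  prime_over_plane_curve (l_homog i) f_homog l0 nlf Pp lP fP.
have Ql : curve_on (l i) Q by exists h, c; split.
have IQ : {subset I <= Q}.
  by apply: ideal_gen2P => //; have [b ->] := lg; exact: prime_idealMl.
have Qmin : is_minimal_prime I Q.
  apply: (chain_minimal heightI) => //.
  exact: (curve_not_maximal _ (l_homog i)).
by exists (exist _ Q Qmin).
Qed.

(** The curve found through the generic point [p] itself lies below [p], hence
    equals [p] by minimality. *)
Lemma minimal_prime_curve_on (p : Min I) i :
  l i \in sval p -> curve_on (l i) (sval p).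
Proof.
move=> lp; have [pp Ip pm] := svalP p.
have [q [qp ql]] := curve_through pp lp (minimal_prime_contains_f p).
have [qprime Iq _] := svalP q.
by have -> : sval p = sval q by apply: eq_pred_subset => //; exact: pm.
Qed.

Lemma equal_or_adjacent (p q : Min I) (P : {pred {mpoly k[4]}}) : relevant P ->
  {subset sval p <= P} -> {subset sval q <= P} -> p = q \/ dual_graph p q.
Proof.
move=> Prel pP qP; have [|neq] := pselect (p = q); first by left.
by right; apply: (adjacent heightI _ neq Prel).
Qed.

(** The curve [p] meets the plane [l j = 0] of [q], and through a common point
    passes a component [z] that lies on this plane. Thus [p] and [z] meet, and [z]
    and [q] meet as curves on the same plane. *)
Lemma distance_le2 (p q : Min I) : ele (distance (@dual_graph _ I) p q) (Some 2).
Proof.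
have [i lip] := minimal_prime_on_plane p.
have [j ljq] := minimal_prime_on_plane q.
have pl := minimal_prime_curve_on lip; have ql := minimal_prime_curve_on ljq.
have [P [Prel pP ljP]] :=
  curve_meets_form (ltnSn 2) (l_homog i) pl (ltn0Sn 0) (l_homog j).
have [Pp _ _] := Prel.
have [z [zP zl]] := curve_through Pp ljP (pP _ (minimal_prime_contains_f p)).
have [P' [P'rel zP' qP']] := curves_on_meet (ltnSn 2) (l_homog j) zl ql.
have walk (s : seq (Min I)) : path (@dual_graph _ I) p s -> last p s = q ->
    (size s <= 2)%N -> ele (distance (@dual_graph _ I) p q) (Some 2).
  move=> ps sq ss; apply: (@ele_trans (Some (size s))) => //.
  by apply: einf_lb; exists s.
have [pz|pz] := equal_or_adjacent Prel pP zP;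
  have [zq|zq] := equal_or_adjacent P'rel zP' qP'.
- by apply: (walk [::]) => //=; rewrite pz.
- by apply: (walk [:: q]) => //=; rewrite pz zq.
- by apply: (walk [:: q]) => //=; rewrite -zq pz.
by apply: (walk [:: z; q]) => //=; rewrite pz zq.
Qed.

End ProductOfPlanes.

Theorem proposition2p7 (k : fieldType) (f g : {mpoly k[4]})
    (df dg e : nat) (l : 'I_e -> {mpoly k[4]}) :
  cardinality.infinite_set (@classical_sets.setT k) ->
  f \is df.-homog ->
  g \is dg.-homog ->
  (forall i : 'I_e, l i \is 1.-homog) ->
  g = (\prod_(i < e) l i)%R ->
  is_gcd f g 1%R ->
  (1%R \notin ideal_gen [:: f; g]) ->
  complete_intersection [:: f; g] ->
  Hirsch (ideal_gen [:: f; g]).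
Proof.
move=> _ fd _ l1 gE fg1 _ heightI; rewrite /Hirsch heightI.
apply: esup_lub => _ [p [q ->]]; exact: distance_le2 fd l1 gE fg1 heightI p q.
Qed.
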